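(* Let $X$ be a Banach space with a Schauder basis $(e_i)_i$. Then the sequence $(e_i)_i$ is convex block homogeneous if and only if $X$ admits an equivalent norm with respect to which $(e_i)_i$ is equal signs additive.
   Context: Banach spaces are real. Two sequences $(x_i)_i$, $(y_i)_i$ in Banach spaces are equivalent if there are constants $c,C>0$ with $c\|\sum a_ix_i\|\leqslant\|\sum a_iy_i\|\leqslant C\|\sum a_ix_i\|$ for all finitely supported scalar sequences $(a_i)_i$. A convex block sequence of $(x_i)_i$ is a sequence $(w_k)_k$ of the form $w_k=\sum_{i\in F_k}c_ix_i$, where $F_1<F_2<\cdots$ are successive finite subsets of $\mathbb{N}$, $c_i\geqslant 0$ and $\sum_{i\in F_k}c_i=1$ for each $k$. A Schauder basic sequence is convex block homogeneous if it is equivalent to each of its convex block sequences. A Schauder basis $(e_i)_i$ is equal signs additive if for any sequence of scalars $(a_i)_i$ (for which $\sum_i a_ie_i$ converges) and any $k\in\mathbb{N}$ with $a_ka_{k+1}\geqslant 0$, $$\Big\|\sum_{i=1}^{k-1}a_ie_i+(a_k+a_{k+1})e_k+\sum_{i=k+2}^\infty a_ie_i\Big\|=\Big\|\sum_{i=1}^\infty a_ie_i\Big\|.$$ *)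

(* Defs.v *)
From mathcomp Require Import all_boot all_order all_algebra finmap.
From mathcomp Require Import all_classical all_reals all_analysis.

Set Implicit Arguments.
Unset Strict Implicit.
Unset Printing Implicit Defensive.

Import Order.TTheory GRing.Theory Num.Theory.
Import numFieldNormedType.Exports.

Local Open Scope classical_set_scope.
Local Open Scope ring_scope.

(* Sequences are indexed from 0 (not from 1) throughout. *)

Definition schauder_basis (R : realType) (X : normedModType R)
    (e : nat -> X) : Prop :=
  forall x : X, exists! a : nat -> R,
    series (fun i => a i *: e i) @ \oo --> x.

(* The pairs (n, a) range over all finitely supported scalar sequences, since
   only the first n terms of a are used. *)
Definition equivalent_seq (R : realType) (X Y : normedModType R)
    (x : nat -> X) (y : nat -> Y) : Prop :=
  exists c C : R, [/\ 0 < c, 0 < C &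
    forall (n : nat) (a : nat -> R),
      c * `|\sum_(i < n) a i *: x i| <= `|\sum_(i < n) a i *: y i| /\
      `|\sum_(i < n) a i *: y i| <= C * `|\sum_(i < n) a i *: x i|].

(* The F k are nonempty because the coefficients over F k add up to 1, so the
   ordering condition does say F 0 < F 1 < ... *)
Definition convex_block_seq (R : realType) (X : normedModType R)
    (x w : nat -> X) : Prop :=
  exists (F : nat -> {fset nat}) (c : nat -> R),
    [/\ forall k i j : nat, i \in F k -> j \in F k.+1 -> (i < j)%N,
        forall k i : nat, i \in F k -> 0 <= c i,
        forall k : nat, \sum_(i <- F k) c i = 1 &
        forall k : nat, w k = \sum_(i <- F k) c i *: x i].

(* Meaningful for Schauder basic sequences. *)
Definition convex_block_homogeneous (R : realType) (X : normedModType R)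
    (x : nat -> X) : Prop :=
  forall w : nat -> X, convex_block_seq x w -> equivalent_seq x w.

(* N is a norm on the vector space X; nonnegativity and N 0 = 0 follow. *)
Definition is_norm (R : realType) (X : lmodType R) (N : X -> R) : Prop :=
  [/\ forall x y : X, N (x + y) <= N x + N y,
      forall (t : R) (x : X), N (t *: x) = `|t| * N x &
      forall x : X, N x = 0 -> x = 0].

Definition equivalent_norm (R : realType) (X : normedModType R)
    (N : X -> R) : Prop :=
  is_norm N /\
  exists c C : R, [/\ 0 < c, 0 < C &
    forall x : X, c * `|x| <= N x /\ N x <= C * `|x|].

(* N is meant to be an equivalent norm, so that the series converge for N
   exactly when they converge in X, with the same sums. *)
Definition equal_signs_additive (R : realType) (X : normedModType R)
    (N : X -> R) (e : nat -> X) : Prop :=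
  forall (a : nat -> R) (k : nat),
    cvgn (series (fun i => a i *: e i)) ->
    0 <= a k * a k.+1 ->
    N (\sum_(0 <= i < k) a i *: e i + (a k + a k.+1) *: e k
       + limn (fun n => \sum_(k.+2 <= i < n) a i *: e i))
    = N (limn (series (fun i => a i *: e i))).

(* Main.v *)
(** Equal signs additivity lets zeros be inserted or deleted and runs of
    coefficients of equal sign be added up without changing the norm; hence
    [sum_k a_k w_k] has the same norm as [sum_k a_k e_k] for every convex block
    sequence [w].

    Conversely, the new norm of [x = sum_i a_i e_i] is the supremum over all
    nondecreasing maps [phi] of the norm of [sum_i a_i e_(phi i)].  Adding up
    [a_k] and [a_(k+1)] does not increase it, as [phi] may be changed to take
    the same value at [k+1] as at [k]; splitting does not increase it either,
    because [(a_k e_p + a_(k+1) e_q)] is a convex combination of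
    [(a_k + a_(k+1)) e_p] and [(a_k + a_(k+1)) e_q].  That the supremum is at
    most [C |x|] is the crux: replace every [e_j] by the average of a long block
    of length [L] (a convex block sequence); up to an error [O(1/L)] the blocks
    used by different [i] can be shifted apart, which turns the sum into an
    average of sums [sum_i a_i e_(n_i)] with [n_i] strictly increasing. *)
Require Import Defs.
From mathcomp Require Import all_boot all_order all_algebra finmap.
From mathcomp Require Import all_classical all_reals all_analysis.
From mathcomp Require Import lra zify.

Set Implicit Arguments.
Unset Strict Implicit.
Unset Printing Implicit Defensive.

Import Order.TTheory GRing.Theory Num.Theory.
Import numFieldNormedType.Exports.

Local Open Scope classical_set_scope.
Local Open Scope ring_scope.

(** * Eventually constant sequences and sums over finite index sets *)

Lemma cvgn_eventually_cst (T : topologicalType) (u : nat -> T) (n0 : nat)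
    (l : T) :
  (forall n, (n0 <= n)%N -> u n = l) -> u @ \oo --> l.
Proof. by move=> ul; apply: cvg_near_cst; exists n0 => //= n /= /ul. Qed.

Lemma big_fset_iota (V : nmodType) (F : {fset nat}) (m M : nat) (f : nat -> V) :
  (forall i, i \in F -> (m <= i < M)%N) ->
  \sum_(i <- F) f i = \sum_(m <= i < M) (if i \in F then f i else 0).
Proof.
move=> FmM; rewrite -[RHS]big_mkcond -[RHS]big_filter; apply: perm_big.
apply: uniq_perm; rewrite ?filter_uniq ?iota_uniq ?fset_uniq// => i.
rewrite mem_filter mem_index_iota.
by case iF: (i \in F) => //=; rewrite FmM.
Qed.

(** * Equal signs additivity implies convex block homogeneity *)

Section EqualSignsAdditive.
Context (R : realType) (X : normedModType R) (e : nat -> X).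

(** Coefficients are kept in a list, so that inserting a zero or merging two neighbours, which
    shifts all later indices, is plain list surgery. *)
Definition lincomb (s : seq R) : X := \sum_(0 <= i < size s) s`_i *: e i.

Lemma sum_nth_stable (s : seq R) (m n : nat) : (m <= size s)%N ->
  (size s <= n)%N ->
  \sum_(m <= i < n) s`_i *: e i = \sum_(m <= i < size s) s`_i *: e i.
Proof.
move=> ms sn; rewrite (big_cat_nat ms sn) /= [X in _ + X]big_nat_cond.
rewrite [X in _ + X]big1 ?addr0// => i.
by move=> /andP[/andP[si _] _]; rewrite nth_default// scale0r.
Qed.

Lemma lincomb_cat (s t : seq R) :
  lincomb (s ++ t) = lincomb s + \sum_(0 <= i < size t) t`_i *: e (size s + i).
Proof.
rewrite /lincomb size_cat (big_cat_nat (n := size s)) ?leq_addr//=; congr (_ + _).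
  by apply: eq_big_nat => i /andP[_ il]; rewrite nth_cat il.
rewrite -{1}(add0n (size s)) big_addn addKn; apply: eq_bigr => i _.
by rewrite nth_cat ltnNge leq_addl /= addnK addnC.
Qed.

Lemma lincomb_series_cvg (s : seq R) :
  series (fun i => s`_i *: e i) @ \oo --> lincomb s.
Proof.
apply: (cvgn_eventually_cst (n0 := size s)) => n sn.
by rewrite /series/= sum_nth_stable.
Qed.

Context (N : X -> R).
Hypothesis Nesa : equal_signs_additive N e.

(** Equal signs additivity leaves a gap at position [k.+1]; this is the [0] that follows [a + b]. *)
Lemma esa_merge0 (p q : seq R) (a b : R) : 0 <= a * b ->
  N (lincomb (p ++ [:: a + b, 0 & q])) = N (lincomb (p ++ [:: a, b & q])).
Proof.
move=> ab; pose s := p ++ [:: a, b & q].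
have sE : s`_(size p) = a by rewrite /s nth_cat ltnn subnn.
have sE1 : s`_(size p).+1 = b.
  by rewrite /s nth_cat ltnNge leqnSn /= subSnn.
have cs := @lincomb_series_cvg s.
(* The default value [0] extends [s] to a sequence whose series is eventually constant. *)
have := @Nesa (nth 0 s) (size p) (cvgP _ cs).
rewrite sE sE1 (cvg_lim _ cs)// => /(_ ab) <-; congr N.
have -> : limn (fun n => \sum_((size p).+2 <= i < n) s`_i *: e i) =
    \sum_((size p).+2 <= i < size s) s`_i *: e i.
  apply: cvg_lim => //; apply: (cvgn_eventually_cst (n0 := size s)) => n sn.
  by rewrite sum_nth_stable// /s size_cat /= !addnS !ltnS leq_addr.
rewrite /lincomb size_cat /= !addnS.
rewrite (big_cat_nat (n := size p)) ?leqW ?leq_addr//=.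
rewrite -addrA; congr (_ + _).
  apply: eq_big_nat => i /andP[_ il]; rewrite /s !nth_cat il//.
rewrite big_ltn ?ltnS ?leqW ?leq_addr// big_ltn ?ltnS ?leq_addr//.
rewrite nth_cat ltnn subnn nth_cat ltnNge leqnSn /= subSnn /= scale0r add0r.
congr (_ + _); rewrite /s size_cat /= !addnS.
apply: eq_big_nat => i /andP[il _]; rewrite !nth_cat.
have -> : (i < size p)%N = false by lia.
by have [j ->] : exists j, (i - size p = j.+2)%N by exists (i - size p - 2)%N; lia.
Qed.

Lemma lincomb_rcons0 (p : seq R) : lincomb (rcons p 0) = lincomb p.
Proof. by rewrite -cats1 lincomb_cat big_nat1 /= scale0r addr0. Qed.

(** Merging [0] with its right neighbour [b] turns [0, b] into [b, 0]; so the zero travels to the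
    end of the list, where it drops out. *)
Lemma esa_insert0 (p q : seq R) : N (lincomb (p ++ 0 :: q)) = N (lincomb (p ++ q)).
Proof.
elim: q p => [|b q IH] p; first by rewrite cats1 lincomb_rcons0 cats0.
by rewrite -esa_merge0 ?mul0r// add0r -!(cat_rcons b) IH.
Qed.

Lemma esa_merge (p q : seq R) (a b : R) : 0 <= a * b ->
  N (lincomb (p ++ [:: a, b & q])) = N (lincomb (p ++ a + b :: q)).
Proof.
by move=> ab; rewrite -esa_merge0// -(cat_rcons (a + b)) esa_insert0 cat_rcons.
Qed.

(** No two entries [t * c] have opposite signs, so they can be merged one by one from the right; for
    an empty run, a zero is inserted. *)
Lemma esa_collapse (t : R) (p q g : seq R) : all (fun c => 0 <= c) g ->
  N (lincomb (p ++ [seq t * c | c <- g] ++ q)) =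
  N (lincomb (p ++ t * (\sum_(c <- g) c) :: q)).
Proof.
elim: g p => [|c g IH] p /=; first by rewrite big_nil mulr0 esa_insert0.
move=> /andP[c0 g0]; rewrite big_cons -(cat_rcons (t * c)).
rewrite IH// cat_rcons esa_merge ?mulrDr//.
rewrite mulrACA -expr2 mulr_ge0 ?sqr_ge0 ?mulr_ge0// big_seq sumr_ge0// => i.
by move=> /(allP g0).
Qed.

(** Indices between [size p] and [M] that lie outside [F] get the coefficient zero; the whole run
    then collapses to a single entry. *)
Lemma esa_block (p : seq R) (F : {fset nat}) (c : nat -> R) (t : R) (M : nat) :
  (forall i, i \in F -> (size p <= i < M)%N) ->
  (forall i, i \in F -> 0 <= c i) ->
  (size p <= M)%N ->
  exists p' : seq R, [/\ size p' = M,
    lincomb p + t *: (\sum_(i <- F) c i *: e i) = lincomb p' &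
    forall q, N (lincomb (p' ++ q)) =
              N (lincomb (p ++ t * (\sum_(i <- F) c i) :: q))].
Proof.
move=> FM c0 pM.
pose g := [seq (if i \in F then c i else 0) | i <- index_iota (size p) M].
exists (p ++ [seq t * x | x <- g]); split.
- by rewrite size_cat !size_map size_iota subnKC.
- rewrite lincomb_cat !size_map size_iota; congr (_ + _).
  rewrite (big_fset_iota _ FM) scaler_sumr.
  rewrite -{1}(add0n (size p)) big_addn; apply: eq_big_nat => i /andP[_ iM].
  rewrite (nth_map 0) ?size_map ?size_iota// (nth_map 0%N) ?size_iota//.
  rewrite nth_iota// [(i + _)%N]addnC.
  by case: ifP => _; rewrite ?mulr0 ?scaler0 ?scale0r ?scalerA.
- move=> q; rewrite -catA esa_collapse; last first.
    by apply/allP => x /mapP[i _ ->]; case: ifP => // /c0.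
  by rewrite (big_fset_iota _ FM) big_map.
Qed.

Lemma esa_convex_block (w : nat -> X) (n : nat) (a : nat -> R) :
  convex_block_seq e w ->
  N (\sum_(i < n) a i *: w i) = N (\sum_(i < n) a i *: e i).
Proof.
move=> [F [c [Fltn c0 c1 wE]]].
have Fne k : exists i, i \in F k.
  apply: contrapT => iF; have := c1 k.
  rewrite big_seq big1 => [/eqP|j jF]; first by rewrite eq_sym oner_eq0.
  by exfalso; apply: iF; exists j.
(* For the induction on [n], [p] accumulates the coefficients along [e] of the blocks already
   expanded. *)
suff H m p : (forall i, i \in F m -> (size p <= i)%N) ->
    N (lincomb p + \sum_(m <= i < m + n) a i *: w i) =
    N (lincomb (p ++ [seq a i | i <- iota m n])).
  have := H 0%N [::] (fun _ _ => isT).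
  rewrite /lincomb big_nil add0r add0n cat0s !big_mkord => ->; congr N.
  rewrite size_map size_iota; apply: eq_bigr => i _.
  by rewrite (nth_map 0%N) ?size_iota// nth_iota.
elim: n m p => [|n IH] m p Fp.
  by rewrite addn0 big_geq// addr0 cats0.
(* One past the largest index of [F m]: a list of length [M] covers this block and stops before
   [F m.+1] begins. *)
pose M := (\max_(i <- F m) i).+1.
have FM i : i \in F m -> (size p <= i < M)%N.
  by move=> iF; rewrite Fp//= ltnS; exact: leq_bigmax_seq.
have pM : (size p <= M)%N.
  by have [i /FM /andP[pi iM]] := Fne m; exact: ltnW (leq_ltn_trans pi iM).
have [p' [sp' p'E Np']] := esa_block (a m) FM (c0 m) pM.
rewrite big_ltn ?addnS ?ltnS ?leq_addr// addrA wE p'E -addSn.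
rewrite IH; first by rewrite Np' c1 mulr1.
rewrite sp' => j jF; have [i0 i0F] := Fne m.
have j0 : (0 < j)%N by exact: leq_ltn_trans (Fltn _ _ _ i0F jF).
rewrite /M -(prednK j0) ltnS; apply/bigmax_leqP_seq => i iF _.
by rewrite -ltnS prednK// (Fltn _ _ _ iF jF).
Qed.

Lemma esa_convex_block_homogeneous :
  equivalent_norm N -> convex_block_homogeneous e.
Proof.
move=> [_ [c [C [c0 C0 cNC]]]] w we; exists (c / C), (C / c).
split; [exact: divr_gt0|exact: divr_gt0|move=> n a].
have Nwe := esa_convex_block n a we.
have [cw wC] := cNC (\sum_(i < n) a i *: w i).
have [ce eC] := cNC (\sum_(i < n) a i *: e i).
rewrite Nwe in cw wC; split.
  by rewrite mulrAC ler_pdivrMr// [leRHS]mulrC (le_trans ce).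
by rewrite mulrAC ler_pdivlMr// [leLHS]mulrC (le_trans cw).
Qed.

End EqualSignsAdditive.

(** * Averages over successive intervals, and concatenation of finite pieces *)

Definition block_avg (R : realType) (X : normedModType R) (e : nat -> X)
    (b : nat * nat) : X :=
  (b.2 - b.1)%N%:R^-1 *: \sum_(b.1 <= i < b.2) e i.

(** Nonemptiness is tested on [b'], so that in [path block_lt (0, m)] the starting pair only encodes
    that all blocks lie at or after [m]. *)
Definition block_lt (b b' : nat * nat) : bool := (b.2 <= b'.1 < b'.2)%N.

Definition blocks_from (m : nat) (B : nat -> nat * nat) : Prop :=
  forall i, [/\ (m <= (B i).1)%N, ((B i).1 < (B i).2)%N &
                ((B i).2 <= (B i.+1).1)%N].

Lemma blocks_from_disjoint (m : nat) (B : nat -> nat * nat) (k l : nat) :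
  blocks_from m B -> (k < l)%N -> ((B k).2 <= (B l).1)%N.
Proof.
move=> HB; elim: l => // l IH; rewrite ltnS leq_eqVlt => /orP[/eqP->|/IH kl].
  by case: (HB l).
by case: (HB l) => _ lt_l le_l; apply: leq_trans kl (leq_trans (ltnW lt_l) le_l).
Qed.

Lemma block_avg_convex (R : realType) (X : normedModType R) (e : nat -> X)
    (m : nat) (B : nat -> nat * nat) :
  blocks_from m B -> convex_block_seq e (block_avg e \o B).
Proof.
move=> HB.
have Binj k l i : ((B k).1 <= i < (B k).2)%N -> ((B l).1 <= i < (B l).2)%N -> k = l.
  move=> /andP[ki ik] /andP[li il]; case: (ltngtP k l) => // kl.
    by have := blocks_from_disjoint HB kl; lia.
  by have := blocks_from_disjoint HB kl; lia.
pose len k : R := ((B k).2 - (B k).1)%N%:R.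
have len0 k : len k != 0 by rewrite pnatr_eq0; case: (HB k); lia.
(* One coefficient function has to serve all blocks, so [c i] looks up the block containing [i],
   which is unique by [Binj]. *)
pose c i := if pselect (exists k, ((B k).1 <= i < (B k).2)%N) is left h
            then (len (projT1 (cid h)))^-1 else 0.
have cE k i : ((B k).1 <= i < (B k).2)%N -> c i = (len k)^-1.
  rewrite /c => ik; case: pselect => [h|[]]; last by exists k.
  by case: (cid h) => l /= /(Binj k l _ ik) ->.
pose F k := [fset i in index_iota (B k).1 (B k).2]%fset.
have inF k i : (i \in F k) = ((B k).1 <= i < (B k).2)%N.
  by rewrite inE /= mem_index_iota.
have FE k (V : nmodType) (f : nat -> V) :
    \sum_(i <- F k) f i = \sum_((B k).1 <= i < (B k).2) f i.
  rewrite (@big_fset_iota _ _ (B k).1 (B k).2) => [|i]; last by rewrite inF.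
  by apply: eq_big_nat => i ik; rewrite inF ik.
exists F, c; split => [k i j|k i|k|k].
- by rewrite !inF => /andP[_ ik] /andP[kj _]; case: (HB k); lia.
- by rewrite inF => /cE ->; rewrite invr_ge0 ler0n.
- rewrite FE (eq_big_nat _ _ (cE k)) sumr_const_nat -[_^-1 *+ _]mulr_natr.
  by rewrite mulVf.
- rewrite FE /= /block_avg scaler_sumr; apply: eq_big_nat => i /cE ->//.
Qed.

(** The stages are prefixes of one another and grow at each step, so entry [i] of the limit can be
    read off stage [i.+1]. *)
Lemma infinite_concatenation (T : Type) (x0 : T) (P : seq T -> seq T) :
  (forall s, (0 < size (P s))%N) ->
  exists f : nat -> T, forall n,
    let S := iter n (fun s => s ++ P s) [::] in
    (n <= size S)%N /\ S = mkseq f (size S).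
Proof.
move=> P0; pose S n := iter n (fun s => s ++ P s) [::].
have sS n : (n <= size (S n))%N.
  elim: n => // n IH; rewrite /= size_cat -addn1; exact: leq_add.
have Spre n k : exists t, S (n + k)%N = S n ++ t.
  elim: k => [|k [t IH]]; first by exists [::]; rewrite addn0 cats0.
  by exists (t ++ P (S (n + k)%N)); rewrite addnS /= -/(S _) {1}IH catA.
exists (fun i => nth x0 (S i.+1) i) => n /=; split; first exact: sS.
apply: (@eq_from_nth _ x0) => [|i iS]; first by rewrite size_mkseq.
rewrite nth_mkseq// -/(S n) -[nth _ (_ ++ _) _]/(nth x0 (S i.+1) i).
case: (leqP n i.+1) => ni.
  by have [t] := Spre n (i.+1 - n)%N; rewrite subnKC// => ->; rewrite nth_cat iS.
have [t] := Spre i.+1 (n - i.+1)%N; rewrite subnKC ?(ltnW ni)// => St.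
by rewrite St nth_cat sS.
Qed.

Lemma path_block_lt (j m k : nat) (B : nat -> nat * nat) :
  blocks_from m B -> path block_lt (j, m) (mkseq B k).
Proof.
move=> HB; apply/(pathP (0, 0)%N) => i; rewrite size_mkseq => ik.
rewrite /block_lt nth_mkseq//; case: (HB i) => mi -> _; rewrite andbT.
case: i ik mi => //= i ik mi; rewrite nth_mkseq ?(ltnW ik)//.
by case: (HB i).
Qed.

Lemma path_block_lt_head (x y : nat * nat) (s : seq (nat * nat)) :
  (x.2 <= y.2)%N -> path block_lt y s -> path block_lt x s.
Proof.
case: s => //= z s xy /andP[/andP[yz zz] ->]; rewrite andbT.
by rewrite /block_lt (leq_trans xy yz).
Qed.

Lemma blocks_from_prefixes (B : nat -> nat * nat) :
  (forall n, exists2 k, (n <= k)%N & path block_lt (0, 0)%N (mkseq B k)) ->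
  blocks_from 0 B.
Proof.
move=> H i; have [k ik] := H i.+2.
move=> /(pathP (0, 0)%N) Hp; split=> //.
  have := Hp i; rewrite size_mkseq nth_mkseq ?(ltnW ik)// => /(_ isT).
  by move=> /andP[].
have := Hp i.+1; rewrite size_mkseq => /(_ ik) /=.
by rewrite !nth_mkseq// ?(ltnW ik)// => /andP[].
Qed.

(** * Estimates for the averaging argument *)

Lemma ler_of_le_add_div (R : realType) (x y c : R) : 0 <= c ->
  (forall n : nat, x <= y + c / n.+1%:R) -> x <= y.
Proof.
move=> c0 H; apply/ler_addgt0Pr => eps eps0.
apply: le_trans (H (Num.bound (c / eps))) _; rewrite lerD2l.
rewrite ler_pdivrMr// mulrC -ler_pdivrMr//.
have /archi_boundP/ltW/le_trans-> // : 0 <= c / eps by rewrite divr_ge0// ltW.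
by rewrite ler_nat.
Qed.

(** Grouping the indices on which [phi] agrees yields a sum over distinct vectors, to which a
    domination between sequences applies. *)
Lemma sum_scale_reindex (R : realType) (X : normedModType R) (phi : nat -> nat)
    (n M : nat) (a : nat -> R) (y : nat -> X) :
  (forall i, (i < n)%N -> (phi i < M)%N) ->
  \sum_(i < n) a i *: y (phi i) =
  \sum_(j < M) (\sum_(i < n | phi i == j) a i) *: y j.
Proof.
move=> phiM; under [RHS]eq_bigr do rewrite scaler_suml.
rewrite (exchange_big_dep xpredT)//=; apply: eq_bigr => i _.
by rewrite (big_pred1 (Ordinal (phiM i (ltn_ord i)))).
Qed.

(** Each shift of the window by one exchanges only two terms. The bound is independent of [L], so it
    becomes [O(1/L)] for averages. *)
Lemma shifted_sum_dist (R : realType) (X : normedModType R) (f : nat -> X)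
    (K : R) (L i : nat) : (forall j, `|f j| <= K) ->
  `|\sum_(t < L) f (i + t)%N - \sum_(t < L) f t| <= i%:R * (K + K).
Proof.
move=> fK; elim: i => [|i IH]; first by rewrite subrr normr0 mul0r.
have step : \sum_(t < L) f (i.+1 + t)%N =
    \sum_(t < L) f (i + t)%N + (f (i + L)%N - f i).
  rewrite addrA; apply/eqP; rewrite -subr_eq opprK addrC; apply/eqP.
  rewrite -(big_mkord xpredT (fun t => f (i + t)%N)).
  rewrite -(big_mkord xpredT (fun t => f (i.+1 + t)%N)).
  rewrite [RHS]addrC -(big_nat_recr L 0 (fun t => f (i + t)%N))//=.
  rewrite big_nat_recl// addn0 [RHS]addrC.
  by congr (_ + _); apply: eq_bigr => t _; rewrite addSnnS.
rewrite step addrAC (le_trans (ler_normD _ _))// -natr1 mulrDl mul1r lerD//.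
by rewrite (le_trans (ler_normB _ _))// lerD.
Qed.

Lemma block_avg1 (R : realType) (X : normedModType R) (e : nat -> X) (i : nat) :
  block_avg e (i, i.+1) = e i.
Proof. by rewrite /block_avg/= subSnn invr1 scale1r big_nat1. Qed.

(** * Convex block homogeneity bounds all nondecreasing changes of indices *)

Section ConvexBlockHomogeneous.
Context (R : realType) (X : normedModType R) (e : nat -> X).
Hypothesis ecbh : convex_block_homogeneous e.

(** Both sequences of averages are equivalent to [e], which links them; here [K] may still depend on
    [B] and [B']. *)
Lemma block_avg_dominated (B B' : nat -> nat * nat) :
  blocks_from 0 B -> blocks_from 0 B' ->
  exists2 K : R, 0 < K & forall (n : nat) (a : nat -> R),
    `|\sum_(i < n) a i *: block_avg e (B i)| <=
    K * `|\sum_(i < n) a i *: block_avg e (B' i)|.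
Proof.
move=> /(block_avg_convex e)/ecbh[c [C [c0 C0 H]]].
move=> /(block_avg_convex e)/ecbh[c' [C' [c'0 C'0 H']]].
exists (C / c') => [|n a]; first exact: divr_gt0.
have [_ /le_trans->//] := H n a; rewrite -mulrA ler_pM2l//.
by rewrite mulrC ler_pdivlMr// mulrC; case: (H' n a).
Qed.

(* Were there no uniform constant, counterexamples with larger and larger
   constants could be concatenated into two block sequences that are both
   equivalent to [e], hence to each other. *)
Lemma block_avg_uniformly_dominated :
  exists m (D : R), 0 < D /\ forall B B' : nat -> nat * nat,
    blocks_from m B -> blocks_from m B' -> forall (n : nat) (a : nat -> R),
    `|\sum_(i < n) a i *: block_avg e (B i)| <=
    D * `|\sum_(i < n) a i *: block_avg e (B' i)|.
Proof.
apply: contrapT => nH.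
(* An entry is a coefficient with its block in the first and its block in the second sequence. *)
pose T := (R * ((nat * nat) * (nat * nat)))%type.
pose V1 (s : seq T) := \sum_(x <- s) x.1 *: block_avg e x.2.1.
pose V2 (s : seq T) := \sum_(x <- s) x.1 *: block_avg e x.2.2.
pose b1 (x : T) := x.2.1; pose b2 (x : T) := x.2.2.
have piece (mk : nat * nat) : exists s : seq T,
    [/\ path block_lt (0, mk.1)%N (map b1 s), path block_lt (0, mk.1)%N (map b2 s) &
        mk.2.+1%:R * `|V2 s| < `|V1 s|].
  case: mk => m k /=; apply: contrapT => ns; apply: nH.
  exists m, k.+1%:R; split; first exact: ltr0Sn.
  move=> B B' HB HB' n a; rewrite leNgt; apply/negP => Hlt; apply: ns.
  exists (mkseq (fun i => (a i, (B i, B' i))) n); split.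
  - rewrite -map_comp; exact: (path_block_lt 0 n HB).
  - rewrite -map_comp; exact: (path_block_lt 0 n HB').
  - by rewrite /V1 /V2 !big_map -(subn0 n) -/(index_iota 0 n) !big_mkord.
have [P0 HP0] := choice piece.
(* The next piece starts after the last blocks of both sequences, and violates the constant
   [(size s).+1]. *)
pose end_ (s : seq T) :=
  maxn (last (0, 0)%N (map b1 s)).2 (last (0, 0)%N (map b2 s)).2.
pose P s := P0 (end_ s, size s).
have Pgt0 s : (0 < size (P s))%N.
  have [_ _] := HP0 (end_ s, size s); rewrite -/(P s).
  by case: (P s) => //; rewrite /V1 /V2 !big_nil !normr0 mulr0 ltxx.
have [f Hf] := @infinite_concatenation T (0, ((0, 0), (0, 0))%N) P Pgt0.
pose S n := iter n (fun s => s ++ P s) [::].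
have pathS n : path block_lt (0, 0)%N (map b1 (S n)) /\
               path block_lt (0, 0)%N (map b2 (S n)).
  elim: n => //= n [IH1 IH2]; rewrite -/(S n) !map_cat !cat_path IH1 IH2 /=.
  have [H1 H2 _] := HP0 (end_ (S n), size (S n)).
  by split; [apply: path_block_lt_head H1|apply: path_block_lt_head H2];
    rewrite ?leq_maxl ?leq_maxr.
have SE n : (n <= size (S n))%N /\ S n = mkseq f (size (S n)) := Hf n.
have [K K0 HK] : exists2 K : R, 0 < K & forall (n : nat) (a : nat -> R),
    `|\sum_(i < n) a i *: block_avg e (b1 (f i))| <=
    K * `|\sum_(i < n) a i *: block_avg e (b2 (f i))|.
  apply: (@block_avg_dominated (b1 \o f) (b2 \o f));
    apply: blocks_from_prefixes => n; exists (size (S n)); rewrite ?(SE n).1//;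
    have [] := pathS n; rewrite {1 2}(SE n).2 -!map_comp//.
(* [K < n <= size s], so the piece appended to stage [n] violates the constant [K]; the coefficients
   [a] vanish before that piece and thus isolate it. *)
pose n := Num.bound K; pose s := S n; pose N1 := size s.
pose N := size (S n.+1).
have NE : N = (N1 + size (P s))%N by rewrite /N /= size_cat.
pose a i := if (i < N1)%N then 0 else (f i).1.
have sumE (g : T -> X) :
    \sum_(i < N) a i *: g (f i) = \sum_(x <- P s) x.1 *: g x.
  have -> : P s = [seq f i | i <- index_iota N1 N].
    have := drop_size_cat (P s) (erefl N1).
    rewrite -[s ++ P s]/(S n.+1) (SE n.+1).2 => <-.
    by rewrite -map_drop drop_iota.
  rewrite big_map -(big_mkord xpredT (fun i => a i *: g (f i))).
  rewrite (big_cat_nat (n := N1)) ?NE ?leq_addr//= [X in X + _]big_nat_cond.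
  rewrite big1 ?add0r => [|i]; last by rewrite andbT /a => /= ->; rewrite scale0r.
  by apply: eq_big_nat => i /andP[Ni _]; rewrite /a ltnNge Ni.
have := HK N a; rewrite (sumE (fun x => block_avg e (b1 x))).
rewrite (sumE (fun x => block_avg e (b2 x))) leNgt => /negP; apply.
have [_ _] := HP0 (end_ s, size s); apply: le_lt_trans.
apply: ler_wpM2r => //=; apply: ltW; apply: lt_le_trans (archi_boundP (ltW K0)) _.
by rewrite ler_nat leqW// (SE n).1.
Qed.

Lemma nondecreasing_dominated :
  exists2 C : R, 0 < C & forall phi : nat -> nat, {homo phi : i j / (i <= j)%N} ->
    forall (n : nat) (a : nat -> R),
    `|\sum_(i < n) a i *: e (phi i)| <= C * `|\sum_(i < n) a i *: e i|.
Proof.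
have [m [D [D0 HD]]] := block_avg_uniformly_dominated.
(* Singleton blocks make subsequences of [e] a special case. The uniform constant [D] needs blocks
   from [m] on; [K1] and [K2] pass between [e i] and [e (m + i)]. *)
pose pt (f : nat -> nat) i := (f i, (f i).+1).
have ptB k f : (forall i, (k <= f i < f i.+1)%N) -> blocks_from k (pt f).
  by move=> H i; case/andP: (H i) => kf ff; split.
have pt0 : blocks_from 0 (pt id) by apply: ptB => i /=.
have ptm k : (k <= m)%N -> blocks_from k (pt (addn m)) by move=> km; apply: ptB => i; lia.
have ptE (f : nat -> nat) n (a : nat -> R) :
    \sum_(i < n) a i *: block_avg e (pt f i) = \sum_(i < n) a i *: e (f i).
  by apply: eq_bigr => i _; rewrite block_avg1.
have [K1 K10 HK1] := block_avg_dominated pt0 (ptm 0%N isT).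
have [K2 K20 HK2] := block_avg_dominated (ptm 0%N isT) pt0.
(* Domination of one-term sums bounds [e] from index [m] on. *)
have eb j : `|e (m + j)%N| <= D * `|e m|.
  have jB : blocks_from m (pt (fun i => m + j + i)%N) by apply: ptB => i; lia.
  have := HD _ _ jB (ptm m (leqnn m)) 1%N (fun=> 1).
  by rewrite !big_ord1 /pt !block_avg1 !scale1r !addn0.
have C0 : 0 < K1 * (D * (D * K2)) by rewrite !mulr_gt0.
exists (K1 * (D * (D * K2))) => // phi phi_mono n a.
have phin i : (i < n)%N -> (phi i < (phi n).+1)%N.
  by move=> lin; rewrite ltnS phi_mono// ltnW.
(* [E / L] will bound the cost of shifting the [i]-th average by [i] places; since [E] does not
   depend on [L], letting [L] grow removes it. *)
pose E : R := \sum_(i < n) `|a i| * (i%:R * (D * `|e m| + D * `|e m|)).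
have E0 : 0 <= E.
  by apply: sumr_ge0 => i _; rewrite !mulr_ge0 ?addr_ge0 ?mulr_ge0// ltW.
apply: (@ler_of_le_add_div _ _ _ (K1 * (D * E))) => [|L0].
  by rewrite !mulr_ge0// ltW.
set L := L0.+1.
rewrite -!mulrA -mulrDr -mulrDr (sum_scale_reindex a e phin).
set b := fun j => \sum_(i < n | phi i == j) a i.
apply: (@le_trans _ _ (K1 * `|\sum_(j < (phi n).+1) b j *: e (m + j)%N|)).
  by have := HK1 (phi n).+1 b; rewrite !ptE.
rewrite ler_pM2l//.
(* Consecutive blocks of length [L], the first starting at [m]. *)
pose v j := (m + j * L, m + j * L + L)%N.
have vB : blocks_from m v by move=> i; rewrite /v /=; split; nia.
apply: (@le_trans _ _ (D * `|\sum_(j < (phi n).+1) b j *: block_avg e (v j)|)).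
  by have := HD _ _ (ptm m (leqnn m)) vB (phi n).+1 b; rewrite !ptE.
rewrite ler_pM2l// -(sum_scale_reindex a (block_avg e \o v) phin) /=.
(* The average over the block [v (phi i)] moved right by [i]: for fixed [t] the indices
   [phi i * L + i + t] increase strictly with [i], even where [phi] is constant. *)
pose u i : X := L%:R^-1 *: \sum_(t < L) e (m + (phi i * L + i + t))%N.
have uv i : `|block_avg e (v (phi i)) - u i| <=
    i%:R * (D * `|e m| + D * `|e m|) / L%:R.
  rewrite /block_avg /v /u /= addKn -scalerBr normrZ ger0_norm ?invr_ge0//.
  rewrite mulrC ler_pM2r ?invr_gt0 ?ltr0Sn//.
  have -> : \sum_(m + phi i * L <= j < m + phi i * L + L) e j =
      \sum_(t < L) e (m + (phi i * L + t))%N.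
    rewrite -{1}(add0n (m + _)%N) big_addn addKn big_mkord.
    by apply: eq_bigr => t _; rewrite addnC addnA.
  rewrite distrC; under eq_bigr do rewrite -addnA.
  apply: (shifted_sum_dist (f := fun t => e (m + (phi i * L + t))%N)) => j.
  exact: eb.
have -> : \sum_(i < n) a i *: block_avg e (v (phi i)) =
    \sum_(i < n) a i *: u i + \sum_(i < n) a i *: (block_avg e (v (phi i)) - u i).
  by rewrite -big_split /=; apply: eq_bigr => i _; rewrite -scalerDr addrC subrK.
apply: (le_trans (ler_normD _ _)); apply: lerD; last first.
  rewrite /E mulr_suml; apply: (le_trans (ler_norm_sum _ _ _)).
  by apply: ler_sum => i _; rewrite normrZ -mulrA ler_wpM2l// mulrA.
(* Exchanging the sums gives an average over [t] of sums along subsequences of [e], each controlled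
   by [D] and [K2]. *)
have -> : \sum_(i < n) a i *: u i = L%:R^-1 *: \sum_(t < L) \sum_(i < n)
    a i *: e (m + (phi i * L + i + t))%N.
  rewrite exchange_big scaler_sumr; apply: eq_bigr => i _.
  by rewrite -scaler_sumr !scalerA mulrC.
rewrite normrZ ger0_norm ?invr_ge0// mulrC ler_pdivrMr//.
apply: (le_trans (ler_norm_sum _ _ _)).
rewrite mulr_natr -[in leRHS](card_ord L) -sumr_const; apply: ler_sum => t _.
have tB : blocks_from m (pt (fun i => m + (phi i * L + i + t))%N).
  by apply: ptB => i; have := phi_mono i i.+1 (leqnSn i); nia.
have := HD _ _ tB (ptm m (leqnn m)) n a; rewrite !ptE => /le_trans-> //.
rewrite ler_pM2l//.
by have := HK2 n a; rewrite !ptE.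
Qed.

End ConvexBlockHomogeneous.

(** * The renorming by a supremum over nondecreasing maps *)

Lemma cvgn_eventually_add (R : realType) (X : normedModType R) (u v : nat -> X)
    (n0 : nat) (l d : X) :
  (forall n, (n0 <= n)%N -> v n = u n + d) ->
  u @ \oo --> l -> v @ \oo --> l + d.
Proof.
move=> vu ul; have uld : (fun n => u n + d) @ \oo --> l + d.
  by apply: cvgD ul _; exact: cvg_cst.
apply: cvg_trans uld; apply: near_eq_cvg; exists n0 => //= n /= nn.
by rewrite vu.
Qed.

Lemma cvg_series_change2 (R : realType) (X : normedModType R) (u v : nat -> X)
    (k : nat) (l : X) :
  (forall i, i != k -> i != k.+1 -> v i = u i) ->
  series u @ \oo --> l ->
  series v @ \oo --> l + (v k + v k.+1 - (u k + u k.+1)).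
Proof.
move=> uv; apply: (cvgn_eventually_add (n0 := k.+2)) => n kn; rewrite /series /=.
apply/eqP; rewrite addrC -subr_eq -sumrB; apply/eqP.
rewrite (big_cat_nat (n := k)) ?(ltnW (ltnW kn))//=.
rewrite big_nat_cond big1 ?add0r => [|i]; last first.
  by rewrite andbT => /= ik; rewrite uv ?subrr//; lia.
rewrite big_ltn 1?ltnW// big_ltn// big_nat_cond big1 ?addr0 => [|i]; last first.
  by rewrite andbT => /andP[ki _]; rewrite uv ?subrr//; lia.
by rewrite addrACA opprD.
Qed.

Section SpreadNorm.
Context (R : realType) (X : completeNormedModType R) (e : nat -> X).
Hypothesis he : schauder_basis e.

Definition basis_coef (x : X) : nat -> R := projT1 (cid (he x)).

Lemma basis_coefP (x : X) : series (fun i => basis_coef x i *: e i) @ \oo --> x.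
Proof. by rewrite /basis_coef; case: (cid _) => a /= []. Qed.

Lemma basis_coef_unique (x : X) (a : nat -> R) :
  series (fun i => a i *: e i) @ \oo --> x -> basis_coef x = a.
Proof.
by rewrite /basis_coef; case: (cid _) => b /= [_ bU] ax; exact: bU.
Qed.

Context (C : R).
Hypotheses (C0 : 0 < C)
  (HC : forall phi : nat -> nat, {homo phi : i j / (i <= j)%N} ->
    forall (n : nat) (a : nat -> R),
    `|\sum_(i < n) a i *: e (phi i)| <= C * `|\sum_(i < n) a i *: e i|).

(** For nondecreasing [phi] this is the bounded linear operator sending [e i] to [e (phi i)]. *)
Definition spread (phi : nat -> nat) (x : X) : X :=
  limn (series (fun i => basis_coef x i *: e (phi i))).

(** Putting zeros for the first [m] coefficients extends [HC] to the sums in the Cauchy criterion,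
    which gives convergence of the spread series. *)
Lemma spread_sum_le (phi : nat -> nat) (a : nat -> R) (m n : nat) :
  {homo phi : i j / (i <= j)%N} ->
  `|\sum_(m <= i < n) a i *: e (phi i)| <= C * `|\sum_(m <= i < n) a i *: e i|.
Proof.
move=> phi_mono; case: (leqP m n) => [mn|nm]; last first.
  by rewrite !big_geq ?(ltnW nm)// !normr0 mulr0.
have sumE (y : nat -> X) : \sum_(m <= i < n) a i *: y i =
    \sum_(i < n) (if (i < m)%N then 0 else a i) *: y i.
  rewrite -(big_mkord xpredT (fun i => (if (i < m)%N then 0 else a i) *: y i)).
  rewrite [RHS](big_cat_nat (n := m))//= [X in _ = X + _]big_nat_cond.
  rewrite [X in _ = X + _]big1.
    by rewrite add0r; apply: eq_big_nat => i /andP[mi _]; rewrite ltnNge mi.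
  by move=> i; rewrite andbT => /= ->; rewrite scale0r.
rewrite (sumE (e \o phi)) (sumE e).
exact: (HC phi_mono n (fun i => if (i < m)%N then 0 else a i)).
Qed.

Lemma spread_cvg (phi : nat -> nat) (x : X) : {homo phi : i j / (i <= j)%N} ->
  series (fun i => basis_coef x i *: e (phi i)) @ \oo --> spread phi x.
Proof.
move=> phi_mono; apply/cauchy_cvgP/cauchy_seriesP => eps eps0.
have /cvgP/cauchy_cvgP/cauchy_seriesP := basis_coefP (x := x).
move=> /(_ (eps / C)); rewrite divr_gt0// => /(_ isT); apply: filterS => -[m n] /=.
by rewrite ltr_pdivlMr// mulrC; apply: le_lt_trans; exact: spread_sum_le.
Qed.

Lemma spread_lim (phi : nat -> nat) (x y : X) : {homo phi : i j / (i <= j)%N} ->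
  series (fun i => basis_coef x i *: e (phi i)) @ \oo --> y -> spread phi x = y.
Proof. by move=> phi_mono; exact: cvg_lim. Qed.

Lemma spread_le (phi : nat -> nat) (x : X) : {homo phi : i j / (i <= j)%N} ->
  `|spread phi x| <= C * `|x|.
Proof.
move=> phi_mono.
have xl : (fun n => C * `|series (fun i => basis_coef x i *: e i) n|) @ \oo --> C * `|x|.
  by apply: cvgM; [exact: cvg_cst|apply: cvg_norm; exact: basis_coefP].
apply: ler_cvg_to (cvg_norm (spread_cvg (x := x) phi_mono)) xl _.
by apply: nearW => n; exact: spread_sum_le.
Qed.

Lemma basis_coefD (x y : X) : basis_coef (x + y) = (fun i => basis_coef x i + basis_coef y i).
Proof.
apply: basis_coef_unique; rewrite (_ : series _ =
  series (fun i => basis_coef x i *: e i) + series (fun i => basis_coef y i *: e i)).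
  by apply: cvgD; exact: basis_coefP.
apply/funext => n; rewrite fctE /series /= -big_split.
by apply: eq_bigr => i _; rewrite scalerDl.
Qed.

Lemma basis_coefZ (t : R) (x : X) : basis_coef (t *: x) = (fun i => t * basis_coef x i).
Proof.
apply: basis_coef_unique; rewrite (_ : series _ =
  t \*: series (fun i => basis_coef x i *: e i)).
  by apply: cvgZl_tmp; exact: basis_coefP.
apply/funext => n; rewrite /series /= scaler_sumr.
by apply: eq_bigr => i _; rewrite scalerA.
Qed.

Lemma spreadD (phi : nat -> nat) (x y : X) : {homo phi : i j / (i <= j)%N} ->
  spread phi (x + y) = spread phi x + spread phi y.
Proof.
move=> phi_mono; apply: spread_lim => //; rewrite (_ : series _ =
  series (fun i => basis_coef x i *: e (phi i)) + series (fun i => basis_coef y i *: e (phi i))).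
  by apply: cvgD; exact: spread_cvg.
apply/funext => n; rewrite fctE /series /= -big_split.
by apply: eq_bigr => i _; rewrite basis_coefD scalerDl.
Qed.

Lemma spreadZ (phi : nat -> nat) (t : R) (x : X) : {homo phi : i j / (i <= j)%N} ->
  spread phi (t *: x) = t *: spread phi x.
Proof.
move=> phi_mono; apply: spread_lim => //; rewrite (_ : series _ =
  t \*: series (fun i => basis_coef x i *: e (phi i))).
  by apply: cvgZl_tmp; exact: spread_cvg.
apply/funext => n; rewrite /series /= scaler_sumr.
by apply: eq_bigr => i _; rewrite basis_coefZ scalerA.
Qed.

Lemma spread_id (x : X) : spread id x = x.
Proof. by apply: spread_lim => //; exact: basis_coefP. Qed.

Definition spread_norm (x : X) : R :=
  sup [set `|spread phi x| |
    phi in [set phi : nat -> nat | {homo phi : i j / (i <= j)%N}]].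

Lemma spread_normP (phi : nat -> nat) (x : X) : {homo phi : i j / (i <= j)%N} ->
  `|spread phi x| <= spread_norm x.
Proof.
move=> phi_mono; apply: ub_le_sup; last by exists phi.
by exists (C * `|x|) => _ [psi psi_mono <-]; exact: spread_le.
Qed.

Lemma spread_norm_le (x : X) (r : R) :
  (forall phi, {homo phi : i j / (i <= j)%N} -> `|spread phi x| <= r) ->
  spread_norm x <= r.
Proof.
move=> H; apply: ge_sup; first by exists `|spread id x|; exists id.
by move=> _ [phi phi_mono <-]; exact: H.
Qed.

Lemma norm_le_spread_norm (x : X) : `|x| <= spread_norm x.
Proof. by rewrite -{1}(spread_id x); exact: spread_normP. Qed.

Lemma spread_normZ_le (t : R) (x : X) : spread_norm (t *: x) <= `|t| * spread_norm x.
Proof.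
apply: spread_norm_le => phi phi_mono; rewrite spreadZ// normrZ ler_wpM2l//.
exact: spread_normP.
Qed.

Lemma spread_norm_equivalent : equivalent_norm spread_norm.
Proof.
split; first split.
- move=> x y; apply: spread_norm_le => phi phi_mono.
  rewrite spreadD// (le_trans (ler_normD _ _))// lerD//; exact: spread_normP.
- move=> t x; apply/eqP; rewrite eq_le spread_normZ_le /=.
  have [->|t0] := eqVneq t 0.
    by rewrite normr0 mul0r (le_trans _ (norm_le_spread_norm _)).
  (* The reverse inequality is the same bound for the scalar [t^-1] and the vector [t *: x]. *)
  rewrite mulrC -ler_pdivlMr ?normr_gt0// mulrC -normfV.
  by rewrite -{1}(scalerK t0 x); exact: spread_normZ_le.
- move=> x x0; have := norm_le_spread_norm x.
  by rewrite x0 normr_le0 => /eqP.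
exists 1, C; split => // x; rewrite mul1r norm_le_spread_norm.
by split=> //; apply: spread_norm_le => phi; exact: spread_le.
Qed.

Lemma spread_change2 (phi psi : nat -> nat) (x y : X) (k : nat) :
  {homo phi : i j / (i <= j)%N} -> {homo psi : i j / (i <= j)%N} ->
  (forall i, i != k -> i != k.+1 -> phi i = psi i /\ basis_coef x i = basis_coef y i) ->
  spread psi y = spread phi x +
    ((basis_coef y k *: e (psi k) + basis_coef y k.+1 *: e (psi k.+1))
     - (basis_coef x k *: e (phi k) + basis_coef x k.+1 *: e (phi k.+1))).
Proof.
move=> phi_mono psi_mono phipsi; apply: spread_lim => //.
apply: (@cvg_series_change2 _ _ (fun i => basis_coef x i *: e (phi i))
  (fun i => basis_coef y i *: e (psi i)) k) (spread_cvg (x := x) phi_mono).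
by move=> i ik ik1; have [-> ->] := phipsi i ik ik1.
Qed.

Lemma spread_norm_esa : equal_signs_additive spread_norm e.
Proof.
move=> a k /cvg_ex[x ax] ab; rewrite (cvg_lim _ ax)//.
have xE := basis_coef_unique ax.
pose a' i := if i == k then a k + a k.+1 else if i == k.+1 then 0 else a i.
have a'k : a' k = a k + a k.+1 by rewrite /a' eqxx.
have a'k1 : a' k.+1 = 0 by rewrite /a' eqxx gtn_eqF.
have a'E i : i != k -> i != k.+1 -> a' i = a i.
  by rewrite /a' => /negPf -> /negPf ->.
have -> : limn (fun n => \sum_(k.+2 <= i < n) a i *: e i) =
    x - \sum_(0 <= i < k.+2) a i *: e i.
  apply: cvg_lim => //; apply: (cvgn_eventually_add (n0 := k.+2)) ax => n kn.
  by rewrite /series /= [X in _ = X - _](big_cat_nat (n := k.+2))//= addrAC subrr add0r.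
rewrite !big_nat_recr//=.
set s := \sum_(0 <= i < k) a i *: e i.
(* The vector with merged coefficients [a'], written as a finite correction of [x]. *)
pose y := x + ((a' k *: e k + a' k.+1 *: e k.+1) - (a k *: e k + a k.+1 *: e k.+1)).
have -> : s + (a k + a k.+1) *: e k + (x - (s + a k *: e k + a k.+1 *: e k.+1)) = y.
  rewrite /y a'k a'k1 scale0r addr0 addrCA -!addrA !opprD; congr (_ + _).
  by rewrite addrCA addNKr.
have yE : basis_coef y = a'.
  apply: basis_coef_unique; apply: (@cvg_series_change2 _ _ (fun i => a i *: e i)
    (fun i => a' i *: e i) k) ax.
  by move=> i ik ik1; rewrite a'E.
have change phi psi z : {homo phi : i j / (i <= j)%N} ->
    {homo psi : i j / (i <= j)%N} ->
    (forall i, i != k -> i != k.+1 -> phi i = psi i) ->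
    (z = x) \/ (z = y) ->
    spread psi z = spread phi x +
      ((basis_coef z k *: e (psi k) + basis_coef z k.+1 *: e (psi k.+1))
       - (a k *: e (phi k) + a k.+1 *: e (phi k.+1))).
  move=> phi_mono psi_mono phipsi zxy.
  rewrite (spread_change2 (phi := phi) (x := x) (k := k)) ?xE// => i ik ik1.
  by split; [exact: phipsi|case: zxy => ->; rewrite ?xE ?yE ?a'E].
apply/eqP; rewrite eq_le; apply/andP; split; apply: spread_norm_le => phi phi_mono.
(* Merging does not increase the norm: sending [k.+1] to [phi k] as well gives
   [spread psi x = spread phi y]. *)
- pose psi i := if i == k.+1 then phi k else phi i.
  have psi_mono : {homo psi : i j / (i <= j)%N}.
    by move=> i j ij; rewrite /psi; case: eqP => ik; case: eqP => jk //;
      apply: phi_mono; lia.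
  have psiE i : i != k -> i != k.+1 -> phi i = psi i by rewrite /psi => _ /negPf->.
  suff -> : spread phi y = spread psi x by exact: spread_normP.
  rewrite (change phi phi y) ?(change phi psi x)//; try by [left|right].
  congr (_ + (_ - _)); rewrite xE yE a'k a'k1 scale0r addr0 /psi eqxx.
  by rewrite ltn_eqF// scalerDl.
(* Splitting does not increase it: [phi] puts the merged coefficient of [y] at [phi k], [psi] puts
   it at [phi k.+1], and [spread phi x] lies between the two results. *)
- pose psi i := if i == k then phi k.+1 else phi i.
  have psi_mono : {homo psi : i j / (i <= j)%N}.
    by move=> i j ij; rewrite /psi; case: eqP => ik; case: eqP => jk //;
      apply: phi_mono; lia.
  have psiE i : i != k -> i != k.+1 -> phi i = psi i by rewrite /psi => /negPf->.
  have phiy : spread phi y = spread phi x + a k.+1 *: (e (phi k) - e (phi k.+1)).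
    rewrite (change phi phi y)//; try by right.
    rewrite yE a'k a'k1 scale0r addr0 scalerDl scalerBr; congr (_ + _).
    by rewrite opprD addrACA subrr add0r.
  have psiy : spread psi y = spread phi x + a k *: (e (phi k.+1) - e (phi k)).
    rewrite (change phi psi y)//; try by right.
    rewrite yE a'k a'k1 scale0r addr0 /psi eqxx scalerDl scalerBr; congr (_ + _).
    by rewrite opprD addrACA subrr addr0.
  (* If the sum is zero, equal signs force both coefficients to vanish, and the two spreads
     coincide. *)
  have [ab0|ab0] := eqVneq (a k + a k.+1) 0.
    have ak0 : a k.+1 = 0 by nra.
    by move: phiy; rewrite ak0 scale0r addr0 => <-; exact: spread_normP.
  (* The convex combination with weights proportional to [a k] and [a k.+1], multiplied out by their
     sum; equal signs then make the absolute values add up. *)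
  have avg : (a k + a k.+1) *: spread phi x =
      a k *: spread phi y + a k.+1 *: spread psi y.
    rewrite phiy psiy -[e (phi k.+1) - e (phi k)]opprB.
    move: (e (phi k) - _) => d; rewrite scalerN scalerDr scalerBr !scalerA.
    by rewrite [a k.+1 * a k]mulrC addrACA subrr addr0 scalerDl.
  have normab : `|a k + a k.+1| = `|a k| + `|a k.+1|.
    by have [a0|a0] := ler0P (a k); have [b0|b0] := ler0P (a k.+1);
      have [c0|c0] := ler0P (a k + a k.+1); nra.
  rewrite -(ler_pM2l (x := `|a k + a k.+1|)) ?normr_gt0// -normrZ avg.
  apply: (le_trans (ler_normD _ _)); rewrite !normrZ normab mulrDl.
  by apply: lerD; apply: ler_wpM2l => //; exact: spread_normP.
Qed.

End SpreadNorm.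

Theorem theorem1 (R : realType) (X : completeNormedModType R) (e : nat -> X)
    (he : schauder_basis e) :
  convex_block_homogeneous e <->
  exists N : X -> R, equivalent_norm N /\ equal_signs_additive N e.
Proof.
split=> [ecbh|[N [Nequiv Nesa]]].
  have [C C0 HC] := nondecreasing_dominated ecbh.
  exists (spread_norm he); split.
    exact: spread_norm_equivalent C0 HC.
  exact: spread_norm_esa C0 HC.
exact: esa_convex_block_homogeneous Nesa Nequiv.
Qed.
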